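(* Let $A\in\mathbb{R}^{M\times N}$ with $M<N$ have nonzero columns, let $d\in\mathbb{R}^M$ and $\beta>0$, and let $F_d(u)=\|Au-d\|_2^2+\beta\|u\|_0$. Let $\hat u$ be a (local) minimizer of $F_d$ and set $\hat\sigma=\sigma(\hat u)$. Then $$\hat u=Z_{\hat\sigma}(\hat u_{\hat\sigma}),\quad\text{where }\hat u_{\hat\sigma}\text{ satisfies}\quad A_{\hat\sigma}^TA_{\hat\sigma}\hat u_{\hat\sigma}=A_{\hat\sigma}^Td.\qquad( * )$$ Conversely, if $\hat u\in\mathbb{R}^N$ satisfies $( * )$ for $\hat\sigma=\sigma(\hat u)$, then $\hat u$ is a (local) minimizer of $F_d$.
   Context: For $u\in\mathbb{R}^N$, $\sigma(u)=\{i\in\{1,\dots,N\}: u[i]\ne0\}$ and $\|u\|_0=\#\sigma(u)$. A point $\hat u$ is a (local) minimizer of $F_d$ if there is an open neighborhood $O$ of $\hat u$ with $F_d(\hat u)=\min_{u\in O}F_d(u)$. For $\omega\subseteq\{1,\dots,N\}$ (listed in increasing order $\omega[1]<\omega[2]<\cdots$), $A_\omega\in\mathbb{R}^{M\times\#\omega}$ is the submatrix of $A$ formed by the columns indexed by $\omega$, $A_\omega^T=(A_\omega)^T$, $u_\omega\in\mathbb{R}^{\#\omega}$ is the corresponding subvector of $u$, and $Z_\omega:\mathbb{R}^{\#\omega}\to\mathbb{R}^N$ is zero padding: $Z_\omega(w)[\omega[k]]=w[k]$ and $Z_\omega(w)[i]=0$ for $i\notin\omega$. For $\omega=\varnothing$: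 $A_\varnothing\in\mathbb{R}^{M\times0}$ and $Z_\varnothing$ gives $0\in\mathbb{R}^N$ (the equation is then vacuous). *)

(* Defs.v *)
From mathcomp Require Import all_boot all_order all_algebra.
From mathcomp Require Import all_classical all_reals all_analysis.

Set Implicit Arguments.
Unset Strict Implicit.
Unset Printing Implicit Defensive.

Import Order.TTheory GRing.Theory Num.Theory.
Import numFieldNormedType.Exports.
Local Open Scope classical_set_scope.
Local Open Scope ring_scope.

(* R^n is 'cV[R]_n, indexed from 0; the topology on it used below is the
   library's product topology, i.e. the usual topology of R^n. *)

Definition supp (R : realType) (n : nat) (u : 'cV[R]_n) : {set 'I_n} :=
  [set i | u i 0 != 0]%SET.

Definition l0norm (R : realType) (n : nat) (u : 'cV[R]_n) : nat := #|supp u|.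

Definition l2norm (R : realType) (n : nat) (u : 'cV[R]_n) : R :=
  Num.sqrt (\sum_i u i 0 ^+ 2).

Definition objective (R : realType) (M N : nat) (A : 'M[R]_(M, N))
    (d : 'cV[R]_M) (beta : R) (u : 'cV[R]_N) : R :=
  l2norm (A *m u - d) ^+ 2 + beta * (l0norm u)%:R.

Definition local_minimizer (R : realType) (n : nat) (F : 'cV[R]_n -> R)
    (u : 'cV[R]_n) : Prop :=
  exists O : set 'cV[R]_n, [/\ open O, O u & forall v, O v -> F u <= F v].

(* For w : {set 'I_n}, [enum_val : 'I_#|w| -> 'I_n] lists w in increasing
   order, so [enum_val k] is the element w[k] of the index set. *)
Definition subcols (R : realType) (m n : nat) (w : {set 'I_n})
    (A : 'M[R]_(m, n)) : 'M[R]_(m, #|w|) :=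
  colsub (fun k : 'I_#|w| => enum_val k) A.

Definition subvec (R : realType) (n : nat) (w : {set 'I_n})
    (u : 'cV[R]_n) : 'cV[R]_#|w| :=
  rowsub (fun k : 'I_#|w| => enum_val k) u.

Definition zeropad (R : realType) (n : nat) (w : {set 'I_n})
    (x : 'cV[R]_#|w|) : 'cV[R]_n :=
  \col_i (if [pick k : 'I_#|w| | enum_val k == i] is Some k then x k 0 else 0).

(* These two properties determine [zeropad]. *)
Lemma zeropad_enum_val (R : realType) (n : nat) (w : {set 'I_n})
  (x : 'cV[R]_#|w|) (k : 'I_#|w|) : zeropad x (enum_val k) 0 = x k 0.
Proof.
rewrite mxE; case: pickP => [j /eqP /enum_val_inj -> //|/(_ k)].
by rewrite eqxx.
Qed.

Lemma zeropad_notin (R : realType) (n : nat) (w : {set 'I_n})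
  (x : 'cV[R]_#|w|) (i : 'I_n) : i \notin w -> zeropad x i 0 = 0.
Proof.
move=> iw; rewrite mxE; case: pickP => // j /eqP ji.
by move: iw; rewrite -ji enum_valP.
Qed.

(* Main.v *)
Require Import Defs.
From mathcomp Require Import all_boot all_order all_algebra.
From mathcomp Require Import all_classical all_reals all_analysis.
From mathcomp Require Import ring lra.

Import Order.TTheory GRing.Theory Num.Theory.
Import numFieldNormedType.Exports.
Local Open Scope ring_scope.

(** Let [g = A^T (A u - d)] be half the gradient of the quadratic term at [u].
Then [F (u + h) - F u = 2 <g, h> + |A h|^2 + beta (|u + h|_0 - |u|_0)], and the
normal equations on the support say that [g] vanishes on [supp u].  Moving a
single coordinate of the support does not enlarge it, so at a local minimizer
[g] vanishes there.  Conversely, for small [h] the support of [u + h] contains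
that of [u]: either they agree and [<g, h> = 0], or the counting term grows by
at least [beta], which beats the small quantity [2 <g, h>]. *)

Definition residual_grad {R : realType} {M N : nat} (A : 'M[R]_(M, N))
    (d : 'cV[R]_M) (u : 'cV[R]_N) : 'cV[R]_N := A^T *m (A *m u - d).

Lemma sqr_l2norm {R : realType} {n : nat} (x : 'cV[R]_n) :
  l2norm x ^+ 2 = \sum_i x i 0 ^+ 2.
Proof. by rewrite sqr_sqrtr // sumr_ge0 // => i _; exact: sqr_ge0. Qed.

(** Balls of the matrix topology are defined entry by entry, so open sets can be traded for one
    radius [e] bounding every coordinate. *)
Lemma local_minimizerP {R : realType} {n : nat} (F : 'cV[R]_n -> R)
    (u : 'cV[R]_n) :
  local_minimizer F u <->
  exists2 e : R, 0 < e &
    forall v : 'cV[R]_n, (forall i, `|v i 0 - u i 0| < e) -> F u <= F v.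
Proof.
split=> [[V [oV Vu Vmin]]|[e e0 emin]].
  have /nbhs_ballP[e /= e0 eV] : nbhs u V by exact: open_nbhs_nbhs.
  exists e => // v uv; apply/Vmin/eV; split=> // i j.
  by rewrite ord1 -ball_normE /= distrC.
have : nbhs u (ball u e) by exact: nbhsx_ballx.
rewrite nbhsE => -[V [oV Vu] Ve]; exists V; split=> // v /Ve[_ uv].
by apply: emin => i; rewrite distrC; exact: uv.
Qed.

Lemma zeropad_subvec_supp {R : realType} {n : nat} (u : 'cV[R]_n) :
  zeropad (subvec (supp u) u) = u.
Proof.
apply/colP => i; have [iu|iu] := boolP (i \in supp u).
  by rewrite -(enum_rankK_in iu iu) zeropad_enum_val mxE.
by rewrite zeropad_notin //; move: iu; rewrite inE negbK => /eqP.
Qed.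

Lemma mul_subcols_supp {R : realType} {M N : nat} (A : 'M[R]_(M, N))
    (u : 'cV[R]_N) :
  subcols (supp u) A *m subvec (supp u) u = A *m u.
Proof.
apply/colP => i; rewrite !mxE [RHS](bigID (mem (supp u))) /=.
rewrite [X in _ + X]big1 ?addr0 => [|j]; last first.
  by rewrite inE negbK => /eqP ->; rewrite mulr0.
by rewrite [RHS]big_enum_val; apply: eq_bigr => k _; rewrite !mxE.
Qed.

(** Since [u] vanishes off [s], the left side is the transposed submatrix applied to [A *m u];
    subtracting the right side leaves the entries of [residual_grad] indexed by [s]. *)
Lemma normal_equations_supp {R : realType} {M N : nat} (A : 'M[R]_(M, N))
    (d : 'cV[R]_M) (u : 'cV[R]_N) (s := supp u) :
  (subcols s A)^T *m subcols s A *m subvec s u = (subcols s A)^T *m d <->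
  {in s, forall i, residual_grad A d u i 0 = 0}.
Proof.
have gE k : ((subcols s A)^T *m (A *m u - d)) k 0
    = residual_grad A d u (enum_val k) 0.
  by rewrite !mxE; apply: eq_bigr => i _; rewrite !mxE.
rewrite -mulmxA mul_subcols_supp; split=> [normal i si|g0].
  by rewrite -(enum_rankK_in si si) -gE mulmxBr normal subrr mxE.
apply/eqP; rewrite -subr_eq0 -mulmxBr; apply/eqP/colP => k.
by rewrite gE g0 ?enum_valP // mxE.
Qed.

Lemma objectiveD {R : realType} {M N : nat} (A : 'M[R]_(M, N))
    (d : 'cV[R]_M) (beta : R) (u h : 'cV[R]_N) :
  objective A d beta (u + h) =
  l2norm (A *m u - d) ^+ 2 + 2 * \sum_j residual_grad A d u j 0 * h j 0
  + \sum_i (A *m h) i 0 ^+ 2 + beta * (l0norm (u + h))%:R.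
Proof.
(* Adjointness: the transpose in [residual_grad] moves onto [h], giving the cross term of the
   expanded square. *)
have -> : \sum_j residual_grad A d u j 0 * h j 0
    = \sum_i (A *m u - d) i 0 * (A *m h) i 0.
  transitivity (((residual_grad A d u)^T *m h) 0 0).
    by rewrite mxE; apply: eq_bigr => j _; rewrite !mxE.
  rewrite trmx_mul trmxK -mulmxA mxE.
  by apply: eq_bigr => i _; rewrite !mxE.
rewrite /objective mulmxDr addrAC !sqr_l2norm mulr_sumr -!big_split /=.
by congr (_ + _); apply: eq_bigr => i _; rewrite !mxE; ring.
Qed.

(** If [a] were nonzero, a short step [t = - (x * a)] would make the linear term dominate and the
    value negative. *)
Lemma small_quadratic_ge0 {R : realFieldType} (a c e : R) :
  0 < e -> 0 <= c ->
  (forall t, `|t| < e -> 0 <= 2 * (a * t) + c * t ^+ 2) -> a = 0.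
Proof.
move=> e0 c0 q; apply/eqP/negPn/negP => a0.
have a_gt0 : 0 < `|a| by rewrite normr_gt0.
(* The first bound gives [x * c < 1], so [2 - x * c] is positive; the second keeps the step within
   [e / 2]. *)
pose x := Num.min (c + 1)^-1 (e / (2 * `|a|)).
have x0 : 0 < x by rewrite lt_min invr_gt0 ltr_wpDl //= divr_gt0 ?mulr_gt0.
have xc : x * (c + 1) <= 1.
  by rewrite -ler_pdivlMr ?ltr_wpDl // div1r ge_min lexx.
have xe : x * (2 * `|a|) <= e.
  by rewrite -ler_pdivlMr ?mulr_gt0 // ge_min lexx orbT.
have := q (- (x * a)); rewrite normrN normrM (gtr0_norm x0).
have -> : 2 * (a * - (x * a)) + c * (- (x * a)) ^+ 2
  = - ((2 - x * c) * (x * a ^+ 2)) by ring.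
have xa_lt : x * `|a| < e by have := mulr_gt0 x0 a_gt0; nra.
have xa_gt0 : 0 < (2 - x * c) * (x * a ^+ 2).
  apply: mulr_gt0; first by nra.
  by rewrite mulr_gt0 ?exprn_even_gt0.
by move=> /(_ xa_lt); rewrite oppr_ge0 leNgt xa_gt0.
Qed.

Lemma local_minimizer_residual_grad {R : realType} {M N : nat}
    (A : 'M[R]_(M, N)) (d : 'cV[R]_M) (beta : R) (u : 'cV[R]_N) :
  0 <= beta -> local_minimizer (objective A d beta) u ->
  {in supp u, forall i, residual_grad A d u i 0 = 0}.
Proof.
move=> beta0 /local_minimizerP[e e0 umin] i ui.
pose c := \sum_k A k i ^+ 2.
apply: (@small_quadratic_ge0 _ _ c e) => // [|t te].
  by apply: sumr_ge0 => k _; exact: sqr_ge0.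
pose h : 'cV[R]_N := t *: delta_mx i 0.
have hE j : h j 0 = t * (j == i)%:R by rewrite !mxE andbT.
have grad_h : \sum_j residual_grad A d u j 0 * h j 0
    = residual_grad A d u i 0 * t.
  rewrite (bigD1 i) //= big1 => [|j /negPf ji]; last by rewrite hE ji !mulr0.
  by rewrite hE eqxx mulr1 addr0.
have Ah : \sum_k (A *m h) k 0 ^+ 2 = c * t ^+ 2.
  rewrite /c mulr_suml; apply: eq_bigr => k _.
  by rewrite -scalemxAr -colE !mxE exprMn mulrC.
(* The step may cancel coordinate [i], so only an inequality holds; it suffices as [beta] is
   nonnegative. *)
have l0 : ((l0norm (u + h))%:R : R) <= (l0norm u)%:R.
  rewrite ler_nat subset_leq_card //; apply/fintype.subsetP => j.
  rewrite inE mxE hE; have [->//|ji] := eqVneq j i.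
  by rewrite mulr0 addr0 inE.
have : objective A d beta u <= objective A d beta (u + h).
  apply: umin => j; rewrite mxE addrAC subrr add0r hE.
  by case: eqP => _; rewrite ?mulr1 ?mulr0 ?normr0.
rewrite objectiveD grad_h Ah /objective.
have := ler_wpM2l beta0 l0; lra.
Qed.

Lemma residual_grad_local_minimizer {R : realType} {M N : nat}
    (A : 'M[R]_(M, N)) (d : 'cV[R]_M) (beta : R) (u : 'cV[R]_N) :
  0 < beta -> {in supp u, forall i, residual_grad A d u i 0 = 0} ->
  local_minimizer (objective A d beta) u.
Proof.
move=> beta0 g0; apply/local_minimizerP.
set g := residual_grad A d u in g0.
pose G := \sum_i `|g i 0|.
have G0 : 0 <= G by apply: sumr_ge0.
(* Chosen so that [e <= b] forces [2 * G * e <= beta]; the [+ 1] avoids dividing by zero when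
   [G = 0]. *)
pose b := beta / (2 * (G + 1)).
have b0 : 0 < b by rewrite divr_gt0 ?mulr_gt0 ?ltr_wpDl.
(* A move smaller than every nonzero entry of [u] cannot cancel one. The default [b] caps [e] and
   covers an empty support. *)
pose e := \big[Num.min/b]_(i in supp u) `|u i 0|.
have e0 : 0 < e.
  by apply: lt_bigmin => // i; rewrite inE normr_gt0.
have eb : e * (2 * (G + 1)) <= beta.
  by rewrite -ler_pdivlMr ?mulr_gt0 ?ltr_wpDl //; exact: bigmin_le_id.
exists e => // v uv; pose h := v - u.
have hE i : h i 0 = v i 0 - u i 0 by rewrite !mxE.
have vE : v = u + h by rewrite addrC subrK.
have suv : supp u \subset supp v.
  apply/fintype.subsetP => i ui; rewrite inE; apply/eqP => vi.
  have := uv i; rewrite vi sub0r normrN ltNge => /negP; apply.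
  exact: bigmin_le_cond.
have Ah0 : 0 <= \sum_k (A *m h) k 0 ^+ 2.
  by apply: sumr_ge0 => k _; exact: sqr_ge0.
rewrite [in leRHS]vE objectiveD -vE /objective -/g.
have [svu|] := eqVneq (supp u) (supp v).
  have -> : \sum_j g j 0 * h j 0 = 0.
    (* On the support [g] vanishes; off it [u] and [v] both do, hence [h] too. *)
    apply: big1 => j _; have [ju|ju] := boolP (j \in supp u).
      by rewrite g0 ?mul0r.
    have := ju; rewrite hE; rewrite {1}svu in ju.
    move: ju; rewrite !inE !negbK => /eqP -> /eqP ->.
    by rewrite subrr mulr0.
  rewrite /l0norm svu; lra.
move=> sneq; have : (l0norm u < l0norm v)%N.
  by apply: proper_card; rewrite finset.properEneq sneq.
rewrite -(ler_nat R) -natr1 => /(ler_wpM2l (ltW beta0)).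
(* Twice this bound is at most [beta], the least gain from an added support element. *)
have : `|\sum_j g j 0 * h j 0| <= G * e.
  apply: le_trans (ler_norm_sum _ _ _) _; rewrite mulr_suml.
  by apply: ler_sum => j _; rewrite normrM ler_wpM2l // hE ltW.
rewrite ler_norml => /andP[]; nra.
Qed.

Theorem corollary2p5 (R : realType) (M N : nat) (A : 'M[R]_(M, N))
    (d : 'cV[R]_M) (beta : R)
    (hMN : (M < N)%N)
    (hA : forall j : 'I_N, col j A != 0)
    (hbeta : 0 < beta) :
  (forall u : 'cV[R]_N,
     local_minimizer (objective A d beta) u ->
     let s := supp u in
     u = zeropad (subvec s u) /\
     (subcols s A)^T *m subcols s A *m subvec s u = (subcols s A)^T *m d) /\
  (forall u : 'cV[R]_N,
     let s := supp u in
     u = zeropad (subvec s u) /\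
     (subcols s A)^T *m subcols s A *m subvec s u = (subcols s A)^T *m d ->
     local_minimizer (objective A d beta) u).
Proof.
split=> [u umin s|u s [_ /normal_equations_supp]].
  split; first by rewrite zeropad_subvec_supp.
  apply/normal_equations_supp.
  exact: local_minimizer_residual_grad (ltW hbeta) umin.
exact: residual_grad_local_minimizer.
Qed.
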